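(* Suppose that $(H_\omega)_{\omega\in\Omega}$ is an ergodic covariant family of operators on $\ell^2(\mathbb{Z}^d)$, with associated functions $E(\omega)$ and $u(\omega)$, and let $\gamma>0$. Suppose that the following hold: (1) there exist measurable sets $\Omega_i\nearrow\Omega$ ($i\ge1$; i.e. $\Omega_i\subset\Omega_{i+1}$ and $\mu(\bigcup_i\Omega_i)=1$), integers $n_i\ge 1$, and constants $C_i>0$ and $0<C_{i,m}<1$ ($0\le m<n_i$), such that for any $\omega\in\Omega_i$, $u(\omega)$ is a $(\gamma,\ell,C_i,C_{i,m})$-good eigenfunction for some $\ell\in\mathbb{Z}^d$ with $|\ell|=m<n_i$; (2) $u:\Omega\to\ell^2(\mathbb{Z}^d)$ is measurable; (3) $\displaystyle\sum_{i=1}^\infty C_i^2\Bigl(1+\sup_{0\le m<n_i}C_{i,m}e^{\gamma m}\Bigr)\mu(\Omega_{i-1}^c)<\infty$, where $\Omega_0:=\emptyset$. Then $(H_\omega)_{\omega\in\Omega}$ displays exponential dynamical localization in expectation (EDL) with exponential decay rate in expectation $\gamma(H)\ge\gamma$.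
   Context: $|n|=|n_1|+\dots+|n_d|$ for $n\in\mathbb{Z}^d$; $(T_nu)(m)=u(m-n)$ for $u\in\ell^2(\mathbb{Z}^d)$. Ergodic family: $(\Omega,\mu)$ is a measurable space with a Borel probability measure and $S=\{S_n:n\in\mathbb{Z}^d\}$ is an ergodic family of one-to-one measure-preserving transformations of $\Omega$ with $S_{m+n}=S_mS_n$. A measurable family $(H_\omega)_{\omega\in\Omega}$ of bounded self-adjoint operators on $\ell^2(\mathbb{Z}^d)$ is ergodic if $H_{S_n\omega}=T_nH_\omega T_{-n}$ for all $n\in\mathbb{Z}^d$. Ergodic covariant family: $(H_\omega)_{\omega\in\Omega}$ is ergodic and there exist a Borel measurable function $E:\Omega\to\mathbb{R}$ and a normalized vector-valued function $u:\Omega\to\ell^2(\mathbb{Z}^d)$ (i.e. $\sum_n|u(\omega)(n)|^2=1$; not necessarily measurable) such that, for $\mu$-a.e. $\omega$, $H_\omega u(\omega)=E(\omega)u(\omega)$ and the vectors $\{T_{-k}u(S_k\omega):k\in\mathbb{Z}^d\}$ are orthonormal. Good eigenfunction: for $\gamma>0$, $\ell\in\mathbb{Z}^d$, $C>0$, $0<C_{|\ell|}<1$, a normalized eigenfunction $u$ is $(\gamma,\ell,C,C_{|\ell|})$-good if $|u(n)|\le C\bigl(e^{-\gamma|n|}+C_{|\ell|}e^{-\gamma|n+\ell|}\bigr)$ for all $n\in\mathbb{Z}^d$. EDL: there are constants $C,\gamma_0>0$ such that $\int_\Omega\sup_{t\in\mathbb{R}}|\langle\delta_k,e^{-itH_\omega}\delta_\ell\rangle|\,d\mu(\omega)\le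 Ce^{-\gamma_0|k-\ell|}$ for all $k,\ell\in\mathbb{Z}^d$. The exponential decay rate in expectation is $\gamma(H)=\liminf_{|n|\to\infty}\left(-\frac1{|n|}\ln\int_\Omega\sup_{t\in\mathbb{R}}|\langle\delta_n,e^{-itH_\omega}\delta_0\rangle|\,d\mu(\omega)\right)$. *)

(* Defs.v *)
From HB Require Import structures.
From mathcomp Require Import all_boot all_order all_algebra.
From mathcomp Require Import complex.
From mathcomp Require Import all_classical all_reals all_analysis.
From mathcomp Require Import ring.
From mathcomp Require summability.

Set Implicit Arguments.
Unset Strict Implicit.
Unset Printing Implicit Defensive.

Import Order.TTheory GRing.Theory Num.Theory.
Import numFieldNormedType.Exports.

Local Open Scope classical_set_scope.
Local Open Scope ring_scope.

Notation lattice d := 'rV[int]_d.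

Notation normc := ComplexField.Normc.normc.

Definition norm1 {d : nat} (n : lattice d) : nat := \sum_(i < d) `|n 0%R i|%N.

Section SquareSum.
Context {R : realType} {d : nat}.
Implicit Types f g : lattice d -> R[i].

Definition sqsum f : \bar R :=
  (\esum_(n in [set: lattice d]) (normc (f n) ^+ 2)%:E)%E.

Definition ell2_pred : {pred lattice d -> R[i]} :=
  [pred f | (sqsum f < +oo)%E].

Lemma normc_ge0 (z : R[i]) : 0 <= normc z.
Proof. by case: z => a b /=; exact: sqrtr_ge0. Qed.

Lemma sqsum_ge0 f : (0 <= sqsum f)%E.
Proof. by apply: esum_ge0 => n _; rewrite lee_fin sqr_ge0. Qed.

Lemma le_esumZ (c : R) (a : lattice d -> \bar R) : 0 <= c ->
  (forall n, 0 <= a n)%E ->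
  (\esum_(n in [set: lattice d]) (c%:E * a n) <=
   c%:E * \esum_(n in [set: lattice d]) a n)%E.
Proof.
move=> c0 a0; apply: ge_ereal_sup => _ [F [finF FT] <-].
rewrite -ge0_mule_fsumr//; apply: lee_wpmul2l; first by rewrite lee_fin.
by apply: esum_ge; exists F.
Qed.

Lemma sqsum0 : sqsum (0 : lattice d -> R[i]) = 0%E.
Proof.
by rewrite /sqsum esum1// => n _; rewrite /= expr0n /= addr0 sqrtr0 expr0n.
Qed.

Lemma le_sqsumZ (c : R[i]) f : (sqsum (c *: f)%R <= (normc c ^+ 2)%:E * sqsum f)%E.
Proof.
rewrite /sqsum; apply: le_trans (le_esumZ _ _); rewrite ?sqr_ge0//; last first.
  by move=> n; rewrite lee_fin sqr_ge0.
apply: le_esum => n _.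
by rewrite -EFinM lee_fin -exprMn -ComplexField.Normc.normcM.
Qed.

Lemma sqsumZ (c : R[i]) f : sqsum (c *: f) = ((normc c ^+ 2)%:E * sqsum f)%E.
Proof.
have [->|c0] := eqVneq c 0.
  by rewrite scale0r sqsum0 ComplexField.Normc.normc0 expr0n mul0e.
have nc0 : normc c != 0.
  by apply: contra c0 => /eqP/ComplexField.Normc.eq0_normc/eqP.
apply/eqP; rewrite eq_le le_sqsumZ /=.
have := le_sqsumZ c^-1 (c *: f); rewrite scalerA mulVf// scale1r => h.
have {h} := lee_wpmul2l (_ : 0%E <= (normc c ^+ 2)%:E)%E h.
rewrite lee_fin sqr_ge0 => /(_ isT) /le_trans; apply.
rewrite muleA -EFinM -exprMn -ComplexField.Normc.normcM mulfV//.
by rewrite ComplexField.Normc.normc1 expr1n mul1e.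
Qed.

Lemma le_sqsumD (t : R) f g : 0 < t ->
  (sqsum (f + g)%R <= (1 + t)%:E * sqsum f + (1 + t^-1)%:E * sqsum g)%E.
Proof.
move=> t0; have t1 : 0 <= 1 + t by rewrite addr_ge0 ?ltW.
have t2 : 0 <= 1 + t^-1 by rewrite addr_ge0 // invr_ge0 ltW.
apply: le_trans (leeD (le_esumZ t1 _) (le_esumZ t2 _)); last 2 first.
- by move=> n; rewrite lee_fin sqr_ge0.
- by move=> n; rewrite lee_fin sqr_ge0.
rewrite -esumD; last 2 first.
- by move=> n _; rewrite mule_ge0// lee_fin// sqr_ge0.
- by move=> n _; rewrite mule_ge0// lee_fin// sqr_ge0.
apply: le_esum => n _; rewrite -!EFinM -EFinD lee_fin.
set a := normc (f n); set b := normc (g n).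
have ab : normc ((f + g) n) <= a + b by exact: le_normcD.
have s0 : 0 <= normc ((f + g) n) by exact: normc_ge0.
apply: (@le_trans _ _ ((a + b) ^+ 2)).
  by rewrite ler_pXn2r// nnegrE// addr_ge0 ?normc_ge0.
rewrite -subr_ge0 (_ : _ - _ = t^-1 * (t * a - b) ^+ 2); last first.
  by field; rewrite gt_eqF.
by rewrite mulr_ge0 ?sqr_ge0// invr_ge0 ltW.
Qed.

Lemma ell2_submod_closed : submod_closed ell2_pred.
Proof.
split=> [|c f g]; rewrite !inE /= ?sqsum0// => f2 g2.
apply: le_lt_trans (le_sqsumD (c *: f) g ltr01) _.
rewrite sqsumZ lte_add_pinfty// lte_mul_pinfty// ?lee_fin ?addr_ge0//.
by rewrite lte_mul_pinfty// lee_fin sqr_ge0.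
Qed.

HB.instance Definition _ := GRing.isSubmodClosed.Build R[i] (lattice d -> R[i])
  ell2_pred ell2_submod_closed.

End SquareSum.

Record ell2 (R : realType) (d : nat) := Ell2 {
  ell2_fun :> lattice d -> R[i] ;
  ell2_funP : ell2_fun \in ell2_pred }.

Section Ell2Space.
Context {R : realType} {d : nat}.

HB.instance Definition _ := [isSub for @ell2_fun R d].
HB.instance Definition _ := [Choice of ell2 R d by <:].
HB.instance Definition _ := [SubChoice_isSubLmodule of ell2 R d by <:].

Implicit Types v w : ell2 R d.

Definition ell2_norm v : R := Num.sqrt (fine (sqsum v)).

Lemma sqsum_fin v : sqsum v \is a fin_num.
Proof. by rewrite ge0_fin_numE ?sqsum_ge0//; have := ell2_funP v. Qed.

Lemma sqr_ell2_norm v : (ell2_norm v ^+ 2)%:E = sqsum v.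
Proof. by rewrite sqr_sqrtr ?fine_ge0 ?sqsum_ge0// fineK// sqsum_fin. Qed.

Lemma ell2_norm_ge0 v : 0 <= ell2_norm v.
Proof. exact: sqrtr_ge0. Qed.

Lemma ell2_norm_eq0 v : ell2_norm v = 0 -> v = 0.
Proof.
move=> v0; have s0 : sqsum v = 0%E by rewrite -sqr_ell2_norm v0 expr0n.
apply: val_inj; apply/funext => n /=; apply: ComplexField.Normc.eq0_normc.
apply/eqP; rewrite -sqrf_eq0 eq_le sqr_ge0 andbT -lee_fin.
apply: (@le_trans _ _ (sqsum v)); last by rewrite s0.
by apply: esum_ge; exists [set n] => //; rewrite fsbig_set1.
Qed.

Lemma ell2_normZ (c : R[i]) v : ell2_norm (c *: v) = normc c * ell2_norm v.
Proof.
rewrite /ell2_norm (_ : sqsum _ = (normc c ^+ 2)%:E * sqsum v)%E; last first.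
  exact: sqsumZ.
by rewrite fineM ?sqsum_fin//= sqrtrM ?sqr_ge0// sqrtr_sqr ger0_norm ?normc_ge0.
Qed.

Lemma ler_ell2_normD v w : ell2_norm (v + w) <= ell2_norm v + ell2_norm w.
Proof.
have [->|v0] := eqVneq v 0; first by rewrite add0r lerDr ell2_norm_ge0.
have [->|w0] := eqVneq w 0; first by rewrite addr0 lerDl ell2_norm_ge0.
have a0 : 0 < ell2_norm v.
  rewrite lt_neqAle ell2_norm_ge0 andbT eq_sym.
  by apply: contra v0 => /eqP/ell2_norm_eq0/eqP.
have b0 : 0 < ell2_norm w.
  rewrite lt_neqAle ell2_norm_ge0 andbT eq_sym.
  by apply: contra w0 => /eqP/ell2_norm_eq0/eqP.
rewrite -(@ler_pXn2r _ 2)// ?nnegrE ?addr_ge0 ?ell2_norm_ge0//.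
have /= := @le_sqsumD R d (ell2_norm w / ell2_norm v) v w (divr_gt0 b0 a0).
rewrite -[sqsum (_ + _)]/(sqsum (v + w)) -!sqr_ell2_norm -!EFinM -EFinD lee_fin.
move=> /le_trans; apply; rewrite le_eqVlt; apply/orP; left; apply/eqP.
by field; rewrite !gt_eqF.
Qed.

Lemma ler_ell2_normDC v w :
  (ell2_norm (v + w))%:C%C <= (ell2_norm v)%:C%C + (ell2_norm w)%:C%C :> R[i].
Proof. by rewrite -rmorphD lecR ler_ell2_normD. Qed.

Lemma ell2_normZC (c : R[i]) v :
  (ell2_norm (c *: v))%:C%C = `|c| * (ell2_norm v)%:C%C.
Proof. by rewrite ell2_normZ rmorphM. Qed.

Lemma ell2_norm_eq0C v : (ell2_norm v)%:C%C = 0 :> R[i] -> v = 0.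
Proof. by move=> /complexI/ell2_norm_eq0. Qed.

HB.instance Definition _ := Lmodule_isNormed.Build R[i] (ell2 R d)
  ler_ell2_normDC ell2_normZC ell2_norm_eq0C.

End Ell2Space.

Section Vectors.
Context {R : realType} {d : nat}.
Implicit Types (v w : ell2 R d) (k m n : lattice d).

Lemma delta_subproof k :
  (fun n => (n == k)%:R : R[i]) \in @ell2_pred R d.
Proof.
rewrite inE /= /sqsum (esumID [set k])//; last first.
  by move=> n _; rewrite lee_fin sqr_ge0.
rewrite setTI setTI [X in (_ + X)%E]esum1 ?adde0; last first.
  move=> n /= /eqP/negbTE ->.
  by rewrite /= expr0n /= addr0 sqrtr0 expr0n.
by rewrite esum_set1 ?ltry// lee_fin sqr_ge0.
Qed.

Definition delta k : ell2 R d := Ell2 (delta_subproof k).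

Lemma translate_subproof n v :
  (fun m => v (m - n)) \in @ell2_pred R d.
Proof.
rewrite inE /=; have := ell2_funP v; rewrite inE /= /sqsum.
rewrite (reindex_esum [set: lattice d] [set: lattice d] (fun m => m - n))//.
split=> //; first by move=> ? ? _ _; exact: addIr.
by move=> m _; exists (m + n) => //; rewrite addrK.
Qed.

Definition translate n v : ell2 R d := Ell2 (translate_subproof n v).

(* Antilinear in the first argument.  [summability.sum] is the unconditional
   sum, i.e. the limit over the directed set of finite subsets of Z^d. *)
Definition inner v w : R[i] :=
  summability.sum (fun n => ((v n)^*)%C * w n : R[i]^o).

Definition normalized v : Prop := sqsum v = 1%E.

Definition orthonormal (I : eqType) (e : I -> ell2 R d) : Prop :=
  forall i j, inner (e i) (e j) = (i == j)%:R.

Definition bounded_operator (A : {linear ell2 R d -> ell2 R d}) : Prop :=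
  exists M : R[i], forall v, `|A v| <= M * `|v|.

Definition self_adjoint (A : {linear ell2 R d -> ell2 R d}) : Prop :=
  forall v w, inner (A v) w = inner v (A w).

(* The exponential series of -itA, summed in the norm of l^2; it converges when
   A is bounded. *)
Definition exp_itA (A : ell2 R d -> ell2 R d) (t : R) (v : ell2 R d) : ell2 R d :=
  limn (series (fun j =>
    ((- ('i%C * t%:C%C)) ^+ j / j`!%:R : R[i]) *: iter j A v)).

Definition eigenfunction (A : ell2 R d -> ell2 R d) v : Prop :=
  v <> 0 /\ exists z : R[i], A v = z *: v.

Definition good_eigenfunction (A : ell2 R d -> ell2 R d) (gamma : R)
    (l : lattice d) (C Cl : R) v : Prop :=
  [/\ normalized v, eigenfunction A v &
    forall n, normc (v n) <=
      C * (expR (- gamma * (norm1 n)%:R) +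
           Cl * expR (- gamma * (norm1 (n + l))%:R))].

Definition sup_evolution (A : ell2 R d -> ell2 R d) k l : \bar R :=
  ereal_sup [set (normc (inner (delta k) (exp_itA A t (delta l))))%:E
            | t in [set: R]].

End Vectors.

Section Families.
Context {R : realType} {d : nat} {disp : measure_display}.
Context {Omega : measurableType disp} (mu : probability Omega R).
Implicit Types (S : lattice d -> Omega -> Omega).
Implicit Types (H : Omega -> {linear ell2 R d -> ell2 R d}).

Definition borel_measurable (T : ptopologicalType) (f : Omega -> T) : Prop :=
  measurable_fun [set: Omega] (f : Omega -> g_sigma_algebraType (@open T)).

Definition ergodic_action S : Prop :=
  [/\ forall n, injective (S n),
      forall n, measurable_fun [set: Omega] (S n),
      forall n A, measurable A -> mu (S n @^-1` A) = mu A,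
      forall m n, S (m + n) = S m \o S n &
      forall A, measurable A -> (forall n, S n @^-1` A = A) ->
        mu A = 0%E \/ mu A = 1%E].

(* Weak measurability of an operator-valued map. *)
Definition measurable_family H : Prop :=
  forall v w, borel_measurable (fun om => inner v (H om w) : R[i]^o).

Definition ergodic_family S H : Prop :=
  [/\ ergodic_action S,
      measurable_family H,
      forall om, bounded_operator (H om) /\ self_adjoint (H om) &
      forall n om v,
        H (S n om) v = translate n (H om (translate (- n) v))].

Definition ergodic_covariant_family S H
    (E : Omega -> R) (u : Omega -> ell2 R d) : Prop :=
  [/\ ergodic_family S H,
      measurable_fun [set: Omega] E,
      forall om, normalized (u om) &
      {ae mu, forall om, H om (u om) = (E om)%:C%C *: u om /\
        orthonormal (fun k => translate (- k) (u (S k om)))}].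

Definition expected_evolution H (k l : lattice d) : \bar R :=
  (\int[mu]_om sup_evolution (H om) k l)%E.

Definition EDL H : Prop :=
  exists C gamma0 : R, [/\ 0 < C, 0 < gamma0 &
    forall k l : lattice d,
      (expected_evolution H k l <=
        (C * expR (- gamma0 * (norm1 (k - l))%:R))%:E)%E].

(* The liminf as |n| -> oo.  The extended logarithm makes the rate +oo at sites
   where the expectation vanishes. *)
Definition decay_rate H : \bar R :=
  ereal_sup (range (fun N : nat =>
    ereal_inf [set (- ((norm1 n)%:R^-1%:E * lne (expected_evolution H n 0%R)))%E
              | n in [set n : lattice d | (N <= norm1 n)%N]])).

End Families.

(* Main.v *)
Require Import Defs.
From HB Require Import structures.
From mathcomp Require Import all_boot all_order all_algebra.
From mathcomp Require Import complex.
From mathcomp Require Import all_classical all_reals all_analysis.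
From mathcomp Require Import finmap measurable_realfun ring lra.
From mathcomp Require summability.

Set Implicit Arguments.
Unset Strict Implicit.
Unset Printing Implicit Defensive.

Import Order.TTheory GRing.Theory Num.Theory.
Import numFieldNormedType.Exports.
Import summability.

Local Open Scope classical_set_scope.
Local Open Scope ring_scope.

#[local] Existing Instance totally_filter.

(** Covariance turns the single eigenvector [u om] into a family: for almost
    every [om] the vectors [e om m], the translates by [- m] of [u (S m om)],
    are orthonormal eigenvectors of [H om] ([ae_eigen_orbit]). They are
    complete for a counting reason ([ae_complete_orbit]): the sum over [m] of
    [|e om m k|^2] is at most 1 by Bessel, while its mean is, because each
    [S m] preserves the measure, the mean of the squared norm of [u], that is 1.

    In such a family the evolution only multiplies coefficients by phases, so
    its matrix element between [k] and [l] is at most the sum over [m] of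
    [|e om m k| |e om m l|] at all times ([sup_evolution_le]). Integrating and
    undoing the shifts once more ([expected_evolution_le]), the expected
    evolution is at most the mean of the sum over [m] of
    [|u om (k + m)| |u om (l + m)|], which involves one eigenvector only.

    For [om] in [Om i], where [u om] is a good eigenfunction with its second
    peak at distance [p], this correlation is at most a constant times
    [C i ^+ 2 * (1 + Cm i p * exp (gamma p)) * exp (- (gamma - eps) |k - l|)],
    for any [eps > 0] ([esum_pair_le]); the constant is twice the sum of
    [exp (- eps |m|)] over the lattice. A point that first enters [Om i] lies
    outside [Om i.-1], so the mean over all [om] is bounded by the series of the
    third hypothesis ([integral_le_layers], [expected_evolution_decay]). Thus
    the expectation decays with every exponent below [gamma], which gives both
    the exponential bound and, as the constants disappear in the limit
    ([decay_rate_ge]), the lower bound on the rate. *)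

(** * Unconditional sums and complex limits *)

Lemma partial_sumE (I : choiceType) (V : zmodType) (x : I -> V) (A : {fset I}) :
  partial_sum x A = \sum_(i \in [set` A]) x i.
Proof.
rewrite /partial_sum fsbig_finite/=; last exact: finite_fset.
by rewrite (big_seq_fsetE _ _ xpredT x) set_fsetK.
Qed.

(** For nonnegative terms the net of finite partial sums is nondecreasing, so
    it converges to its supremum, and that supremum is how [esum] is defined. *)
Lemma cvg_partial_sum_ge0 (R : realType) (I : choiceType) (g : I -> R) :
  (forall i, 0 <= g i) -> (\esum_(i in [set: I]) (g i)%:E < +oo)%E ->
  partial_sum g @ totally --> fine (\esum_(i in [set: I]) (g i)%:E)%E.
Proof.
move=> g0 gfin; set L := esum _ _.
have Lfin : L \is a fin_num.
  by rewrite ge0_fin_numE//; apply: esum_ge0 => i _; rewrite lee_fin.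
have ub A : ((partial_sum g A)%:E <= L)%E.
  apply: esum_ge; exists [set` A]; first by split=> //; exact: finite_fset.
  by rewrite partial_sumE fsumEFin//; exact: finite_fset.
apply/cvgrPdist_le => e e0.
have : (L - e%:E < L)%E by rewrite lteBlDr// lteDl//.
rewrite {2}/L /esum => /ereal_sup_gt[_ [X [Xfin _] <-]] ltX.
exists (fset_set X) => // B /= XB.
have XLe : (L - e%:E <= (partial_sum g B)%:E)%E.
  apply: le_trans (ltW ltX) _; rewrite partial_sumE -fsumEFin; last exact: finite_fset.
  apply: lee_fsum_nneg_subset => //.
  - move=> i /set_mem Xi; apply/mem_set; apply: (fsubsetP XB).
    by rewrite in_fset_set// mem_set.
  - by move=> i _; rewrite lee_fin.
have := ub B; move: XLe; rewrite -(fineK Lfin) -EFinB !lee_fin => h1 h2.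
by rewrite ger0_norm ?subr_ge0// lerBlDr -lerBlDl.
Qed.

Section ComplexModulus.
Variable R : realType.
Implicit Type z : R[i].

Lemma complex_normE z : `|z| = (normc z)%:C%C. Proof. by []. Qed.

Lemma normc_conj z : normc z^*%C = normc z.
Proof. by apply: complexI; rewrite -!complex_normE normcJ. Qed.

Lemma mul_conjc z : z^*%C * z = (normc z ^+ 2)%:C%C.
Proof. by rewrite rmorphXn/= -complex_normE sqr_normc mulrC. Qed.

End ComplexModulus.

Section ComplexNet.
Variables (R : realType) (T : Type) (F : set_system T).
Context {FF : ProperFilter F}.
Implicit Types (f : T -> R[i]) (l : R[i]).

Lemma cvg_complex (a b : T -> R) (a0 b0 : R) : a @ F --> a0 -> b @ F --> b0 ->
  (fun x => (a x)%:C%C + 'i%C * (b x)%:C%C : R[i]^o) @ F -->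
    (a0%:C%C + 'i%C * b0%:C%C : R[i]^o).
Proof.
move=> fa fb; have real_cvg (g : T -> R) (l : R) : g @ F --> l ->
    (fun x => (g x)%:C%C : R[i]^o) @ F --> (l%:C%C : R[i]^o).
  move=> /cvgrPdist_lt gl; apply/cvgrPdist_lt => e e0.
  have eE : (complex.Re e)%:C%C = e by apply: RRe_real; exact: gtr0_real.
  move: e0; rewrite -eE ltcR => e0; apply: filterS (gl _ e0) => x.
  by rewrite -rmorphB /= normc_def /= expr0n addr0 sqrtr_sqr ltcR.
by apply: cvgD; [|apply: cvgMr]; exact: real_cvg.
Qed.

Lemma cvg_normc f l : (f : T -> R[i]^o) @ F --> (l : R[i]^o) ->
  (fun x => normc (f x)) @ F --> normc l.
Proof.
move=> /cvgrPdist_le fl; apply/cvgrPdist_le => e e0.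
have e0' : 0 < e%:C%C :> R[i] by rewrite ltcR.
apply: filterS (fl _ e0') => x fx; rewrite -lecR; apply: le_trans fx.
have := ler_dist_dist l (f x).
by rewrite -rmorphB /= [X in X <= _ -> _]normc_def /= expr0n addr0 sqrtr_sqr.
Qed.

Lemma cvg_conjc f l : (f : T -> R[i]^o) @ F --> (l : R[i]^o) ->
  (fun x => (f x)^*%C : R[i]^o) @ F --> (l^*%C : R[i]^o).
Proof.
move=> /cvgrPdist_le fl; apply/cvgrPdist_le => e e0.
by apply: filterS (fl _ e0) => x; rewrite -rmorphB normcJ.
Qed.
End ComplexNet.

(** A real family [g] dominated by [normc f] is the difference of the two
    nonnegative summable families [g + normc f] and [normc f]; applied to the
    real and imaginary parts of [f], this gives unconditional convergence
    without a completeness argument in [R[i]]. *)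
Lemma cvg_partial_sumC (R : realType) (I : choiceType) (f : I -> R[i]) :
  (\esum_(i in [set: I]) (normc (f i))%:E < +oo)%E ->
  cvg (partial_sum (f : I -> R[i]^o) @ totally).
Proof.
move=> ffin.
pose dom (g : I -> R) := forall i, `|g i| <= normc (f i).
have real_cvg g : dom g -> exists l : R, partial_sum g @ totally --> l.
  move=> gf; have f0 i : 0 <= normc (f i) by exact: le_trans (gf i).
  have -> : partial_sum g = partial_sum (fun i => g i + normc (f i)) \-
            partial_sum (fun i => normc (f i)).
    apply/funext => A; rewrite /partial_sum /= -sumrB.
    by apply: eq_bigr => i _; rewrite addrK.
  eexists; apply: cvgB; apply: cvg_partial_sum_ge0 => //.
    by move=> i; have := gf i; rewrite ler_norml -subr_ge0 opprK => /andP[].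
  apply: le_lt_trans (lte_add_pinfty ffin ffin).
  rewrite -esumD; [|by move=> i _; rewrite lee_fin..].
  apply: le_esum => i _; rewrite -EFinD lee_fin lerD2r.
  exact: le_trans (ler_norm _) (gf i).
have reP : dom (fun i => complex.Re (f i)).
  by move=> i; rewrite -lecR; exact: normc_ge_Re.
have imP : dom (fun i => complex.Im (f i)).
  move=> i; rewrite -normrN -ReiNIm -lecR; apply: le_trans (normc_ge_Re _) _.
  by rewrite normrM -[X in _ * `|X|]complexiE normCi mulr1.
have [a ca] := real_cvg _ reP; have [b cb] := real_cvg _ imP.
apply/cvg_ex; exists (a%:C%C + 'i%C * b%:C%C).
rewrite (_ : partial_sum _ = fun A =>
    (partial_sum (fun i => complex.Re (f i)) A)%:C%C +
    'i%C * (partial_sum (fun i => complex.Im (f i)) A)%:C%C).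
  exact: cvg_complex ca cb.
apply/funext => A; rewrite /partial_sum !raddf_sum /= mulr_sumr -big_split /=.
by apply: eq_bigr => i _; rewrite -complexE.
Qed.

(** * The inner product of square-summable vectors *)

Section Inner.
Context {R : realType} {d : nat}.
Implicit Types (v w x : ell2 R d) (k : lattice d).

(** The inner product is a limit over finite sets, hence unspecified if the
    net diverges. It never does on square-summable vectors, because
    [|a b| <= |a|^2 + |b|^2]; every algebraic law below is then a passage to the
    limit. *)
Lemma inner_cvg v w :
  partial_sum (fun n => (v n)^*%C * w n : R[i]^o) @ totally --> (inner v w : R[i]^o).
Proof.
suff : cvg (partial_sum (fun n => (v n)^*%C * w n : R[i]^o) @ totally) by [].
apply: cvg_partial_sumC; apply: le_lt_trans (lte_add_pinfty (ell2_funP v) (ell2_funP w)).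
rewrite /sqsum -esumD; [|by move=> i _; rewrite lee_fin sqr_ge0..].
apply: le_esum => i _; rewrite -EFinD lee_fin ComplexField.Normc.normcM.
rewrite normc_conj -subr_ge0; set a := normc _; set b := normc _.
have -> : a ^+ 2 + b ^+ 2 - a * b = 2^-1 * (a ^+ 2 + b ^+ 2 + (a - b) ^+ 2) by field.
by rewrite mulr_ge0 ?invr_ge0// !addr_ge0 ?sqr_ge0.
Qed.

Lemma inner_unique v w (l : R[i]) :
  partial_sum (fun n => (v n)^*%C * w n : R[i]^o) @ totally --> (l : R[i]^o) ->
  inner v w = l.
Proof. exact: (cvg_unique _ (@inner_cvg v w)). Qed.

Lemma innerC v w : inner w v = (inner v w)^*%C.
Proof.
apply: inner_unique.
rewrite (_ : partial_sum _ = fun A =>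
  (partial_sum (fun n => (v n)^*%C * w n) A)^*%C).
  exact: cvg_conjc (@inner_cvg _ _).
apply/funext => A; rewrite /partial_sum raddf_sum /=.
by apply: eq_bigr => n _; rewrite rmorphM /= conjcK mulrC.
Qed.

Lemma innerDr v w x : inner v (w + x) = inner v w + inner v x.
Proof.
apply: inner_unique.
rewrite (_ : partial_sum _ =
  partial_sum (fun n => (v n)^*%C * w n : R[i]^o) \+
  partial_sum (fun n => (v n)^*%C * x n : R[i]^o)).
  exact: cvgD (@inner_cvg _ _) (@inner_cvg _ _).
apply/funext => A; rewrite /partial_sum /= -big_split /=.
by apply: eq_bigr => n _; rewrite -mulrDr.
Qed.

Lemma innerZr (a : R[i]) v w : inner v (a *: w) = a * inner v w.
Proof.
apply: inner_unique.
rewrite (_ : partial_sum _ = fun A =>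
  a *: (partial_sum (fun n => (v n)^*%C * w n) A : R[i]^o)).
  exact: cvgZr (@inner_cvg _ _).
apply/funext => A; rewrite /partial_sum /= scaler_sumr.
by apply: eq_bigr => n _; rewrite /= /GRing.scale /= mulrCA.
Qed.

Lemma innerZl (a : R[i]) v w : inner (a *: v) w = a^*%C * inner v w.
Proof. by rewrite innerC innerZr rmorphM /= -innerC. Qed.

Lemma innerDl v w x : inner (v + w) x = inner v x + inner w x.
Proof. by rewrite innerC innerDr rmorphD /= -!innerC. Qed.

Lemma inner0r v : inner v 0 = 0.
Proof. by rewrite -(scale0r 0) innerZr mul0r. Qed.

Lemma innerNr v w : inner v (- w) = - inner v w.
Proof. by rewrite -scaleN1r innerZr mulN1r. Qed.

Lemma innerBr v w x : inner v (w - x) = inner v w - inner v x.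
Proof. by rewrite innerDr innerNr. Qed.

Lemma innerBl v w x : inner (v - w) x = inner v x - inner w x.
Proof. by rewrite innerC innerBr rmorphB /= -!innerC. Qed.

Lemma inner_sumr (I : Type) (r : seq I) v (f : I -> ell2 R d) :
  inner v (\sum_(i <- r) f i) = \sum_(i <- r) inner v (f i).
Proof.
elim: r => [|i r IH]; first by rewrite !big_nil inner0r.
by rewrite !big_cons innerDr IH.
Qed.

Lemma inner_suml (I : Type) (r : seq I) v (f : I -> ell2 R d) :
  inner (\sum_(i <- r) f i) v = \sum_(i <- r) inner (f i) v.
Proof.
rewrite innerC inner_sumr rmorph_sum /=; apply: eq_bigr => i _; exact/esym/innerC.
Qed.

Lemma inner_norm v : inner v v = (ell2_norm v ^+ 2)%:C%C.
Proof.
have v2 : fine (sqsum v) = ell2_norm v ^+ 2 by rewrite -sqr_ell2_norm.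
apply: inner_unique; rewrite -v2 -[X in _ --> X]addr0 -(mulr0 'i%C).
have h := @cvg_partial_sum_ge0 R _ (fun n => normc (v n) ^+ 2)
  (fun=> sqr_ge0 _) (ell2_funP v).
rewrite (_ : partial_sum _ = fun A =>
    (partial_sum (fun n => normc (v n) ^+ 2) A)%:C%C + 'i%C * 0%:C%C).
  exact: cvg_complex h (cvg_cst 0).
apply/funext => A; rewrite mulr0 addr0 /partial_sum rmorph_sum /=.
by apply: eq_bigr => i _; rewrite mul_conjc.
Qed.

Lemma inner_deltal k v : inner (delta k) v = v k.
Proof.
apply: inner_unique; apply: cvg_near_cst; exists [fset k]%fset => // A /= kA.
have kA' : k \in A by apply: (fsubsetP kA); rewrite inE.
rewrite /partial_sum (bigD1 [` kA']%fset)//= eqxx conjc1 mul1r big1 ?addr0//.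
move=> i ik; rewrite (_ : _ == _ = false) ?conjc0 ?mul0r//.
by apply/negbTE; apply: contra ik => /eqP ik; apply/eqP/val_inj.
Qed.

Lemma ell2_norm_delta k : ell2_norm (delta k : ell2 R d) = 1.
Proof.
have := inner_norm (delta k); rewrite inner_deltal /= eqxx => /esym h.
have : ell2_norm (delta k : ell2 R d) ^+ 2 = 1 by apply: (@complexI R).
by move/eqP; rewrite sqrp_eq1 ?ell2_norm_ge0// => /eqP.
Qed.

(** Cauchy-Schwarz, from the nonnegativity of the squared norm of
    [|v|^2 w - <v, w> v]. *)
Lemma norm_inner_le v w : normc (inner v w) <= ell2_norm v * ell2_norm w.
Proof.
have [v0|v0] := eqVneq (ell2_norm v) 0.
  rewrite v0 mul0r (ell2_norm_eq0 v0) -(scale0r 0) innerZl conjc0 mul0r.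
  by rewrite ComplexField.Normc.normc0.
set a := ell2_norm v; set b := ell2_norm w; set z := inner v w.
have a0 : 0 < a by rewrite lt_neqAle eq_sym v0 ell2_norm_ge0.
have h : ell2_norm ((a ^+ 2)%:C%C *: w - z *: v) ^+ 2 =
    a ^+ 2 * (a ^+ 2 * b ^+ 2 - normc z ^+ 2).
  apply: (@complexI R); rewrite -inner_norm innerBl !innerBr !innerZl !innerZr.
  rewrite !inner_norm -/a -/b conjc_real (innerC v w) -/z.
  have realE (r s t : R) :
      (r * (r * s - t))%:C%C = r%:C%C * (r%:C%C * s%:C%C - t%:C%C) :> R[i].
    by rewrite rmorphM rmorphB rmorphM.
  by rewrite realE -mul_conjc -/z; ring.
rewrite -(@ler_pXn2r _ 2)// ?nnegrE ?mulr_ge0 ?ell2_norm_ge0 ?normc_ge0//.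
by rewrite exprMn -subr_ge0 -(pmulr_rge0 _ (exprn_gt0 2 a0)) -h sqr_ge0.
Qed.
End Inner.

(** * Orthonormal families *)

Section Orthonormal.
Context {R : realType} {d : nat} {I : choiceType}.
Variable e : I -> ell2 R d.
Hypothesis orthoe : Defs.orthonormal e.
Implicit Types (w x : ell2 R d) (r : seq I).

(** Pythagoras: the residual is orthogonal to the projection [p] onto the span
    of the [e i], [i] in [r]. *)
Lemma sqr_norm_residual r w : uniq r ->
  ell2_norm (w - \sum_(i <- r) inner (e i) w *: e i) ^+ 2 =
  ell2_norm w ^+ 2 - \sum_(i <- r) normc (inner (e i) w) ^+ 2.
Proof.
move=> ur; set p := \sum_(i <- r) _; apply: (@complexI R).
have ep j : j \in r -> inner (e j) p = inner (e j) w.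
  move=> jr; rewrite /p inner_sumr (bigD1_seq j)//= innerZr orthoe eqxx mulr1.
  rewrite big1 ?addr0// => i ij.
  by rewrite innerZr orthoe eq_sym (negbTE ij) mulr0.
rewrite -inner_norm innerBr.
have -> : inner (w - p) p = 0.
  rewrite {2}/p inner_sumr big_seq big1// => i ir.
  by rewrite innerZr (innerC (e i) (w - p)) innerBr ep// subrr conjc0 mulr0.
rewrite subr0 innerBl [RHS]rmorphB inner_norm; congr (_ - _).
rewrite inner_suml rmorph_sum; apply: eq_bigr => i _.
by rewrite innerZl mul_conjc.
Qed.

Lemma sum_bessel r w : uniq r ->
  \sum_(i <- r) normc (inner (e i) w) ^+ 2 <= ell2_norm w ^+ 2.
Proof. by move=> ur; rewrite -subr_ge0 -sqr_norm_residual// sqr_ge0. Qed.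

Lemma esum_bessel w :
  (\esum_(i in [set: I]) (normc (inner (e i) w) ^+ 2)%:E <=
   (ell2_norm w ^+ 2)%:E)%E.
Proof.
apply: ge_ereal_sup => _ [X [Xfin _] <-].
by rewrite fsumEFin// lee_fin fsbig_finite//= sum_bessel// fset_uniq.
Qed.

(** If the coefficients of [w] exhaust its norm, then finite combinations of
    the [e i] approach [w] by [sqr_norm_residual], and pairing them with [x]
    bounds [<w, x>]. Arguing with finite combinations replaces the expansion
    of [w] by an estimate up to [eps]. *)
Lemma norm_inner_le_parseval w x :
  \esum_(i in [set: I]) (normc (inner (e i) w) ^+ 2)%:E = (ell2_norm w ^+ 2)%:E ->
  ((normc (inner w x))%:E <=
   \esum_(i in [set: I]) (normc (inner (e i) w) * normc (inner (e i) x))%:E)%E.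
Proof.
move=> parseval; apply/lee_addgt0Pr => eps eps0.
have nx : 0 < 1 + ell2_norm x by rewrite ltr_pwDl// ell2_norm_ge0.
(* Enough terms are kept for the residual to have norm at most [t], so that its
   pairing with [x] is at most [eps]. *)
pose t := eps / (1 + ell2_norm x); have t0 : 0 < t by rewrite divr_gt0.
have : ((ell2_norm w ^+ 2 - t ^+ 2)%:E < (ell2_norm w ^+ 2)%:E)%E.
  by rewrite lte_fin ltrBlDr ltrDl exprn_gt0.
rewrite -parseval => /ereal_sup_gt[_ [X [Xfin _] <-]].
rewrite fsumEFin// lte_fin fsbig_finite//= ltrBlDr -ltrBlDl.
rewrite -sqr_norm_residual ?fset_uniq//; set p := \sum_(i <- _) _ *: _ => wpt.
have {}wpt : ell2_norm (w - p) <= t.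
  rewrite -(@ler_pXn2r _ 2)// ?nnegrE ?ell2_norm_ge0 ?(ltW t0)//.
  exact: ltW.
have -> : inner w x = inner p x + inner (w - p) x by rewrite -innerDl addrC subrK.
apply: (@le_trans _ _ (normc (inner p x) + normc (inner (w - p) x))%:E).
  by rewrite lee_fin le_normcD.
rewrite EFinD leeD//; last first.
  rewrite lee_fin; apply: le_trans (norm_inner_le _ _) _.
  apply: (@le_trans _ _ (t * ell2_norm x)).
    by rewrite ler_wpM2r// ell2_norm_ge0.
  by rewrite /t mulrAC ler_pdivrMr// ler_wpM2l ?(ltW eps0)// lerDr.
apply: (@le_trans _ _
    (\sum_(i \in X) (normc (inner (e i) w) * normc (inner (e i) x))%:E)%E).
  rewrite fsumEFin// lee_fin fsbig_finite//= inner_suml.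
  elim: (finmap.enum_fset _) => [|i s IH].
    by rewrite !big_nil ComplexField.Normc.normc0.
  rewrite !big_cons; apply: le_trans (le_normcD _ _) _; apply: lerD => //.
  by rewrite innerZl ComplexField.Normc.normcM normc_conj.
by apply: esum_ge; exists X.
Qed.

End Orthonormal.

(** * Evolution along eigenvectors *)

Section Evolution.
Context {R : realType} {d : nat}.
Implicit Types (v w x : ell2 R d) (k l : lattice d) (t : R).

Lemma ell2_normE v : `|v| = (ell2_norm v)%:C%C. Proof. by []. Qed.

Lemma cvg_inner (T : Type) (F : set_system T) {FF : Filter F}
    (f : T -> ell2 R d) v x : f @ F --> x ->
  (fun j => inner v (f j) : R[i]^o) @ F --> (inner v x : R[i]^o).
Proof.
move=> /cvgrPdist_lt fx; apply/cvgrPdist_lt => e e0.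
have v1 : 0 < 1 + ell2_norm v by rewrite ltr_pwDl// ell2_norm_ge0.
have v1C : 0 < (1 + ell2_norm v)%:C%C :> R[i] by rewrite ltcR.
apply: filterS (fx _ (divr_gt0 e0 v1C)) => j; rewrite ltr_pdivlMr// => fj.
rewrite -innerBr; apply: le_lt_trans fj.
rewrite ell2_normE complex_normE -rmorphM lecR.
apply: le_trans (norm_inner_le _ _) _.
by rewrite mulrC ler_wpM2l ?ell2_norm_ge0// lerDr.
Qed.

(** Since [(- i)^j] is real for even [j] and imaginary for odd [j], the terms
    of the exponential series of [- i y] split into those of cosine and sine. *)
Lemma exp_coeffE (y : R) j :
  (- ('i%C * y%:C%C)) ^+ j / j`!%:R =
  (cos_coeff y j)%:C%C - 'i%C * (sin_coeff y j)%:C%C :> R[i].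
Proof.
rewrite /cos_coeff /sin_coeff /= -exprnP.
have yE : y%:C%C ^+ j / j`!%:R = (y ^+ j / j`!%:R)%:C%C :> R[i].
  by rewrite rmorphM rmorphXn fmorphV rmorph_nat.
have jE : (- 'i%C : R[i]) ^+ j =
   ((~~ odd j)%:R * (-1) ^+ j./2)%:C%C - 'i%C * ((odd j)%:R * (-1) ^+ j.-1./2)%:C%C.
  have sqrN : (- 'i%C : R[i]) ^+ 2 = -1 by rewrite sqrrN sqr_i.
  rewrite -[j in LHS](odd_double_half j) exprD -mul2n exprM sqrN.
  case: (boolP (odd j)) => oj /=; rewrite ?mul0r ?mul1r ?sub0r ?mulr0 ?subr0.
    rewrite (_ : j.-1./2 = j./2) ?rmorphXn ?rmorphN1 ?expr1 ?mulNr//.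
    by rewrite -[in LHS](odd_double_half j) oj /= doubleK.
  by rewrite rmorphXn rmorphN1.
transitivity ((- 'i%C) ^+ j * (y ^+ j / j`!%:R)%:C%C : R[i]).
  by rewrite -yE -mulNr exprMn mulrA.
have mulC (a b : R) : a%:C%C * b%:C%C = (a * b)%:C%C :> R[i] by rewrite rmorphM.
rewrite jE mulrBl mulC -[X in _ - X]mulrA mulC.
by congr (_%:C%C - 'i%C * _%:C%C); rewrite mulrA.
Qed.

Section Eigen.
Variables (A : {linear ell2 R d -> ell2 R d}) (v : ell2 R d) (E : R).
Hypothesis Asa : self_adjoint A.
Hypothesis Av : A v = E%:C%C *: v.

Lemma inner_eigen_iter w j : inner v (iter j A w) = (E%:C%C) ^+ j * inner v w.
Proof.
elim: j => [|j IH] /=; first by rewrite expr0 mul1r.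
by rewrite -Asa Av innerZl conjc_real IH mulrA -exprS.
Qed.

(** On an eigenvector with real eigenvalue [E] the evolution acts by a phase:
    the coefficient along [v] of the partial sums of the exponential series is
    the corresponding partial sum of [exp (- i t E)] times [<v, w>], and the
    limiting factor [cos (t E) - i sin (t E)] has modulus one. If the series
    diverges then its [lim] is the default vector 0, so the inequality holds
    in that case too. *)
Lemma inner_eigen_exp w t :
  normc (inner v (exp_itA A t w)) <= normc (inner v w).
Proof.
rewrite /exp_itA; set S := series _.
have [cS|/dvgP ->] := pselect (cvgn S); last first.
  have -> : (point : ell2 R d) = 0 by [].
  by rewrite inner0r ComplexField.Normc.normc0 normc_ge0.
rewrite le_eqVlt; apply/orP; left; apply/eqP.
have SE j : inner v (S j) = ((series (cos_coeff (t * E)) j)%:C%C +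
    'i%C * (- series (sin_coeff (t * E)) j)%:C%C) * inner v w.
  rewrite /S !seriesEnat inner_sumr rmorphN rmorph_sum rmorph_sum mulrN mulr_sumr.
  rewrite -sumrB mulr_suml; apply: eq_bigr => i _.
  rewrite innerZr inner_eigen_iter mulrA; congr (_ * _).
  rewrite -exp_coeffE mulrAC -exprMn; congr (_ ^+ _ / _).
  by rewrite rmorphM mulNr mulrA.
have cc : series (cos_coeff (t * E)) @ \oo --> cos (t * E).
  by rewrite cos.unlock; exact: is_cvg_series_cos_coeff.
have cs : series (sin_coeff (t * E)) @ \oo --> sin (t * E).
  by rewrite sin.unlock; exact: is_cvg_series_sin_coeff.
have lim_inner : (fun j => normc (inner v (S j))) @ \oo -->
    normc (inner v (limn S)) by exact: cvg_normc (cvg_inner (v := v) cS).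
have lim_mul : (fun j => normc (inner v (S j))) @ \oo -->
    normc (((cos (t * E))%:C%C + 'i%C * (- sin (t * E))%:C%C) * inner v w).
  under eq_fun do rewrite SE.
  exact: cvg_normc (cvgM (cvg_complex cc (cvgN cs)) (cvg_cst (inner v w : R[i]^o))).
rewrite (cvg_unique _ lim_inner lim_mul)// ComplexField.Normc.normcM.
rewrite [X in X * _](_ : _ = 1) ?mul1r//.
set c := cos _; set sn := sin _.
rewrite (_ : _ + _ = (c +i* - sn)%C) /=.
  by rewrite sqrrN cos2Dsin2 sqrtr1.
by simpc.
Qed.

End Eigen.

Lemma sup_evolution_ge0 (A : ell2 R d -> ell2 R d) k l : (0 <= sup_evolution A k l)%E.
Proof.
apply: ereal_sup_ge; exists (normc (inner (delta k) (exp_itA A 0 (delta l))))%:E.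
  by exists 0.
by rewrite lee_fin normc_ge0.
Qed.

(** The coefficients of [delta l] along the eigenvectors do not grow in modulus
    under the evolution, so the bound obtained from Parseval at site [k] does
    not depend on time. *)
Lemma sup_evolution_le (I : choiceType) (A : {linear ell2 R d -> ell2 R d})
    (e : I -> ell2 R d) (E : I -> R) k l :
  self_adjoint A -> Defs.orthonormal e -> (forall i, A (e i) = (E i)%:C%C *: e i) ->
  \esum_(i in [set: I]) (normc (e i k) ^+ 2)%:E = 1%E ->
  (sup_evolution A k l <=
   \esum_(i in [set: I]) (normc (e i k) * normc (e i l))%:E)%E.
Proof.
move=> Asa oe Ae complete.
have ne i n : normc (inner (e i) (delta n)) = normc (e i n).
  by rewrite innerC inner_deltal normc_conj.
apply: ge_ereal_sup => _ [t _ <-].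
apply: le_trans (norm_inner_le_parseval oe _ _) _.
  rewrite ell2_norm_delta expr1n -complete; apply: eq_esum => i _.
  by rewrite ne.
apply: le_esum => i _; rewrite lee_fin ne ler_wpM2l ?normc_ge0//.
by rewrite -(ne _ l); exact: inner_eigen_exp Asa (Ae i) _ _.
Qed.

End Evolution.

(** * Exponential sums over the lattice *)

Lemma leq_norm1B (d : nat) (a b : lattice d) : (norm1 (a - b) <= norm1 a + norm1 b)%N.
Proof.
rewrite /norm1 -big_split; apply: leq_sum => i _.
by rewrite !mxE -lez_nat PoszD !abszE ler_normB.
Qed.

Lemma norm1N (d : nat) (a : lattice d) : norm1 (- a) = norm1 a.
Proof. by apply: eq_bigr => i _; rewrite mxE abszN. Qed.

Lemma norm1_row_mx (d1 d2 : nat) (a : lattice d1) (b : lattice d2) :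
  norm1 (row_mx a b) = (norm1 a + norm1 b)%N.
Proof.
rewrite /norm1 big_split_ord; congr (_ + _)%N; apply: eq_bigr => i _.
  by rewrite row_mxEl.
by rewrite row_mxEr.
Qed.


Section LatticeSum.
Context {R : realType}.

Lemma esum_geometric (q : R) : 0 <= q < 1 ->
  (\esum_(n in [set: nat]) (q ^+ n)%:E <= ((1 - q)^-1)%:E)%E.
Proof.
move=> /andP[q0 q1].
rewrite -nneseries_esumT; last by move=> n; rewrite lee_fin exprn_ge0.
apply: lime_le; first by apply: is_cvg_nneseries => n _ _; rewrite lee_fin exprn_ge0.
apply: nearW => n; rewrite sumEFin lee_fin -[X in X <= _]/(series (fun i => q ^+ i) n).
have -> : (fun i => q ^+ i) = geometric 1 q.
  by apply/funext => i; rewrite /geometric /= mul1r.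
rewrite geometric_seriesE ?lt_eqF//= mul1r ler_pdivrMr ?subr_gt0//.
by rewrite mulVf ?gt_eqF ?subr_gt0// gerBl exprn_ge0.
Qed.

Lemma esum_geometric_int (q : R) : 0 <= q < 1 ->
  (\esum_(n in [set: int]) (q ^+ `|n|%N)%:E < +oo)%E.
Proof.
move=> /[dup] q01 /andP[q0 q1]; rewrite (esumID (range Posz)); last first.
  by move=> n _; rewrite lee_fin exprn_ge0.
rewrite !setTI (_ : ~` range Posz = range Negz); last first.
  apply/seteqP; split=> [[n|n] h|_ [n _ <-] [m _]//]; last by exists n.
  by exfalso; apply: h; exists n.
rewrite !esum_image; [|by move=> ? ? _ _ []..].
apply: lte_add_pinfty; apply: le_lt_trans (ltry (1 - q)^-1).
  exact: esum_geometric.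
apply: le_trans (esum_geometric q01); apply: le_esum => n _.
by rewrite lee_fin /= exprS ler_piMl ?exprn_ge0// ltW.
Qed.

(** Peeling off one coordinate factors out a two-sided geometric series. *)
Lemma esum_exp_norm1 (d : nat) (e : R) : 0 < e ->
  (\esum_(m in [set: lattice d]) (expR (- e * (norm1 m)%:R))%:E < +oo)%E.
Proof.
move=> e0; pose q := expR (- e); have q01 : 0 <= q < 1.
  by rewrite expR_ge0 expR_lt1 oppr_lt0.
have qE k (m : lattice k) : expR (- e * (norm1 m)%:R) = q ^+ norm1 m.
  by rewrite expRM_natr.
under eq_esum do rewrite qE.
elim: d => [|d IH].
  rewrite (_ : [set: lattice 0] = [set 0]).
    by rewrite esum_set1 ?ltry// lee_fin exprn_ge0// expR_ge0.
  by apply/seteqP; split=> m // _; apply/rowP => -[].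
pose glue (k : int * lattice d) : lattice d.+1 := row_mx (const_mx k.1 : lattice 1) k.2.
have normE k : norm1 (glue k) = (`|k.1| + norm1 k.2)%N.
  apply: etrans (@norm1_row_mx 1 d _ _) _; congr (_ + _)%N.
  by rewrite /norm1 big_ord1 mxE.
have bij : set_bij ([set: int] `*`` (fun=> [set: lattice d])) [set: lattice d.+1] glue.
  split=> //.
    move=> [a m] [b n] _ _ ab.
    have [/= {}ab ->] := @eq_row_mx _ 1 1 d _ _ _ _ ab; congr (_, _).
    by move/rowP : ab => /(_ 0); rewrite !mxE.
  move=> m _; exists (m 0 0, rsubmx (m : 'rV_(1 + d))) => //.
  rewrite /glue -[RHS](@hsubmxK _ 1 1 d m); congr (@row_mx _ 1 1 d _ _).
  by apply/rowP => i; rewrite !mxE ord1; congr (m _ _); apply/val_inj.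
rewrite (reindex_esum _ _ _ _ bij).
under eq_esum do rewrite normE exprD EFinM.
rewrite -(esum_esum (a := fun (a : int) (m : lattice d) =>
   (q ^+ `|a|%N)%:E * (q ^+ norm1 m)%:E)%E); last first.
  by move=> a m _ _; rewrite mule_ge0// lee_fin exprn_ge0// expR_ge0.
set L := esum _ _ in IH.
have L0 : (0 <= L)%E by apply: esum_ge0 => m _; rewrite lee_fin exprn_ge0 ?expR_ge0.
have Lfin : L \is a fin_num by rewrite ge0_fin_numE.
apply: (@le_lt_trans _ _ (\esum_(a in [set: int]) (L * (q ^+ `|a|%N)%:E))%E).
  apply: le_esum => a _; rewrite [leRHS]muleC; apply: le_esumZ => [|m].
    by rewrite exprn_ge0// expR_ge0.
  by rewrite lee_fin exprn_ge0// expR_ge0.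
apply: (@le_lt_trans _ _ (L * \esum_(a in [set: int]) (q ^+ `|a|%N)%:E)%E).
  apply: ge_ereal_sup => _ [F [finF FT] <-].
  rewrite -(fineK Lfin) -ge0_mule_fsumr; last first.
    by move=> a; rewrite lee_fin exprn_ge0 ?expR_ge0.
  by rewrite lee_wpmul2l ?fineK//; apply: esum_ge; exists F.
rewrite -(fineK Lfin) lte_mul_pinfty ?lee_fin ?fine_ge0//.
exact: esum_geometric_int.
Qed.

End LatticeSum.

Section PairSum.
Context {R : realType} {d : nat}.
Implicit Types (a b k l m p : lattice d) (g e : R).

Local Notation decay g m := (expR (- g * (norm1 m)%:R)).

(** Of the decay [g (|a| + |b|)], the part [g - e] is spent on the distance
    through [|a - b| <= |a| + |b|], and the part [e] on making the sum over [a]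
    converge. *)
Lemma decayM a b g e : 0 < e -> e <= g ->
  decay g a * decay g b <= decay e a * decay (g - e) (a - b).
Proof.
move=> e0 eg; rewrite -!expRD ler_expR -subr_ge0.
have : ((norm1 (a - b))%:R <= (norm1 a)%:R + (norm1 b)%:R :> R).
  by rewrite -natrD ler_nat leq_norm1B.
have := ler0n R (norm1 b).
set A := (norm1 a)%:R; set B := (norm1 b)%:R; set D := (norm1 _)%:R => B0 DAB.
have -> : - e * A + - (g - e) * D - (- g * A + - g * B) =
  (g - e) * (A + B - D) + e * B by ring.
by rewrite addr_ge0// mulr_ge0 ?subr_ge0// ltW.
Qed.

(** Moving the centre by [p] costs at most [exp (g |p|)]. *)
Lemma decay_shift a p g e : 0 < e -> e <= g ->
  decay (g - e) (a + p) <= decay (g - e) a * expR (g * (norm1 p)%:R).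
Proof.
move=> e0 eg; rewrite -!expRD ler_expR -subr_ge0.
have : ((norm1 a)%:R <= (norm1 (a + p))%:R + (norm1 p)%:R :> R).
  by rewrite -natrD ler_nat -{1}(addrK p a) leq_norm1B.
have := ler0n R (norm1 p).
set A := (norm1 a)%:R; set B := (norm1 p)%:R; set D := (norm1 _)%:R => B0 DAB.
have -> : - (g - e) * A + g * B - - (g - e) * D = (g - e) * (D + B - A) + e * B by ring.
by rewrite addr_ge0// mulr_ge0 ?subr_ge0// ltW.
Qed.

(** The correlation of a function dominated by two exponential peaks, of heights
    1 and [c], at distance [|p|] from each other. Expanding the product gives four
    terms: the peaks paired with themselves decay from [k - l], while the two
    cross terms decay from [k - l - p] and [k - l + p], which costs
    [exp (g |p|)] but carries a factor [c]. This is why the height enters only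
    through [c * exp (g |p|)]. *)
Lemma esum_pair_le (w : lattice d -> R) (C c g e : R) p k l :
  0 < e -> e <= g -> 0 <= c <= 1 -> (forall n, 0 <= w n) ->
  (forall n, w n <= C * (decay g n + c * decay g (n + p))) ->
  (\esum_(m in [set: lattice d]) (w (k + m) * w (l + m))%:E <=
   (C ^+ 2 * (1 + c * expR (g * (norm1 p)%:R)) * decay (g - e) (k - l))%:E *
   (2%:E * \esum_(m in [set: lattice d]) (decay e m)%:E))%E.
Proof.
move=> e0 eg /andP[c0 c1] w0 wle; set L := (\esum_(m in _) (decay e m)%:E)%E.
set G := expR (g * _); set D := decay (g - e) (k - l).
have G0 : 0 <= G by exact: expR_ge0.
have D0 : 0 <= D by exact: expR_ge0.
have cG : 0 <= c * G by rewrite mulr_ge0.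
have shift n : L = (\esum_(m in [set: lattice d]) (decay e (n + m))%:E)%E.
  rewrite /L (reindex_esum [set: lattice d] [set: lattice d] (fun m => n + m))//.
have -> : (2%:E * L = \esum_(m in [set: lattice d])
    (decay e (k + m) + decay e (k + p + m))%:E)%E.
  under eq_esum do rewrite EFinD.
  rewrite esumD; [|by move=> m _; rewrite lee_fin expR_ge0..].
  by rewrite -!shift -mule2n mule_natl.
apply: le_trans (le_esumZ _ _); last 2 first.
- by apply: mulr_ge0 => //; apply: mulr_ge0; [exact: sqr_ge0|exact: addr_ge0].
- by move=> m; rewrite lee_fin addr_ge0 ?expR_ge0.
apply: le_esum => m _; rewrite -EFinM lee_fin.
apply: le_trans (ler_pM _ _ (wle _) (wle _)) _ => //.
have -> : k + p + m = k + m + p by rewrite addrAC.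
set a := k + m; set b := l + m.
have ab : a - b = k - l by rewrite /a /b opprD addrACA subrr addr0.
have h1 : decay g a * decay g b <= decay e a * D by rewrite /D -ab; exact: decayM.
have h2 : decay g a * decay g (b + p) <= decay e a * (D * G).
  apply: le_trans (decayM _ _ e0 eg) _; rewrite ler_wpM2l ?expR_ge0//.
  by rewrite (opprD b p) (addrA a) ab /G -(norm1N p) decay_shift.
have h3 : decay g (a + p) * decay g b <= decay e (a + p) * (D * G).
  apply: le_trans (decayM _ _ e0 eg) _; rewrite ler_wpM2l ?expR_ge0//.
  by rewrite (addrAC a) ab decay_shift.
have h4 : decay g (a + p) * decay g (b + p) <= decay e (a + p) * D.
  apply: le_trans (decayM _ _ e0 eg) _; rewrite ler_wpM2l ?expR_ge0//.
  by rewrite (opprD b p) (addrACA a) subrr addr0 ab.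
move: h1 h2 h3 h4 (expR_ge0 (- e * (norm1 a)%:R)) (expR_ge0 (- e * (norm1 (a + p))%:R)).
set A := decay g a; set B := decay g b; set A' := decay g (a + p).
set B' := decay g (b + p); set x := decay e a; set y := decay e (a + p).
move=> h1 h2 h3 h4 x0 y0.
have -> : C * (A + c * A') * (C * (B + c * B')) =
  C ^+ 2 * (A * B + c * (A * B') + c * (A' * B) + c ^+ 2 * (A' * B')) by ring.
rewrite -[X in _ <= X]mulrA -[X in _ <= X]mulrA; apply: ler_wpM2l (sqr_ge0 C) _ _ _.
apply: (@le_trans _ _ (x * D + c * (x * (D * G)) + c * (y * (D * G)) + c ^+ 2 * (y * D))).
  by rewrite !lerD// ler_wpM2l ?sqr_ge0.
have yD : 0 <= y * D by rewrite mulr_ge0.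
have : c ^+ 2 * (y * D) <= y * D by rewrite ler_piMl// expr_le1.
rewrite -subr_ge0 => h; rewrite -subr_ge0.
by apply: le_trans h _; rewrite le_eqVlt; apply/orP; left; apply/eqP; ring.
Qed.

End PairSum.

(** * Countable sums, null sets and measure-preserving maps *)

Section CountableSum.
Context {R : realType} {I : countType}.

(** Enumerating a countable type turns unordered sums into series, for which
    monotone convergence is available. *)
Lemma esum_pickle (a : I -> \bar R) : (forall i, 0 <= a i)%E ->
  \esum_(i in [set: I]) a i = (\sum_(n <oo) oapp a 0%E (@pickle_inv I n))%E.
Proof.
move=> a0; rewrite nneseries_esumT; last by move=> n; case: pickle_inv.
pose b (n : nat) := oapp a 0%E (@pickle_inv I n).
transitivity (\esum_(i in [set: I]) b (choice.pickle i)).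
  by apply: eq_esum => i _; rewrite /b pickleK_inv.
rewrite -(@esum_image _ _ _ _ _ b); last by move=> ? ? _ _; exact: (pcan_inj pickleK_inv).
rewrite esum_mkcond; apply: eq_esum => n _; case: ifPn => //.
rewrite /b => nP; case E : (@pickle_inv I n) => [i|]//=; case/negP: nP.
apply/mem_set; exists i => //.
by have := @pickle_invK I n; rewrite E.
Qed.

Context {disp : measure_display} {Omega : measurableType disp}.
Variables (mu : {measure set Omega -> \bar R}) (f : I -> Omega -> \bar R).
Hypothesis f0 : forall i om, (0 <= f i om)%E.
Hypothesis mf : forall i, measurable_fun [set: Omega] (f i).

Let g n om := oapp (f^~ om) 0%E (@pickle_inv I n).

Let g0 n om : (0 <= g n om)%E. Proof. by rewrite /g; case: (pickle_inv _) => /=. Qed.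

Let mg n : measurable_fun [set: Omega] (g n).
Proof.
rewrite /g; case: pickle_inv => [i|] /=; [exact: mf|exact: measurable_cst].
Qed.

Let esum_g om : \esum_(i in [set: I]) f i om = (\sum_(n <oo) g n om)%E.
Proof. exact: esum_pickle. Qed.

Lemma measurable_esum :
  measurable_fun [set: Omega] (fun om => \esum_(i in [set: I]) f i om).
Proof.
under eq_fun do rewrite esum_g.
exact: (ge0_emeasurable_sum (P := xpredT) (fun n om _ _ => g0 n om) (fun n _ => mg n)).
Qed.

Lemma integral_esum :
  (\int[mu]_om (\esum_(i in [set: I]) f i om) =
   \esum_(i in [set: I]) (\int[mu]_om f i om))%E.
Proof.
under eq_integral do rewrite esum_g.
rewrite integral_nneseries// esum_pickle; last first.
  by move=> i; exact: integral_ge0.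
apply: eq_eseriesr => n _; rewrite /g; case: pickle_inv => //=.
by rewrite integral0.
Qed.

End CountableSum.

Section AlmostEverywhere.
Context {R : realType} {disp : measure_display} {Omega : measurableType disp}.
Variable mu : probability Omega R.

(** The integral of a nonnegative function is the supremum of the integrals of
    the simple functions below it, so it is monotone whether or not the smaller
    function is measurable; this serves for the supremum over all times of the
    evolution. The larger function is raised to [+oo] on a null set so as to
    dominate everywhere. *)
Lemma ge0_le_integral_ae (f g : Omega -> \bar R) :
  (forall om, 0 <= f om)%E -> (forall om, 0 <= g om)%E ->
  measurable_fun [set: Omega] g -> {ae mu, forall om, (f om <= g om)%E} ->
  (\int[mu]_om f om <= \int[mu]_om g om)%E.
Proof.
move=> f0 g0 mg [N [mN N0 fgN]].
pose h om := (if om \in N then +oo else g om)%E.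
have h0 om : (0 <= h om)%E by rewrite /h; case: ifP.
have mh : measurable_fun [set: Omega] h.
  apply: measurable_fun_ifT => //; apply: (measurable_fun_bool true).
  rewrite setTI (_ : _ @^-1` _ = N)//.
  by apply/seteqP; split=> om /= => [/set_mem|/mem_set].
have -> : (\int[mu]_om g om = \int[mu]_om h om)%E.
  apply: ge0_ae_eq_integral => //; exists N; split => // om /= hom.
  apply: contrapT => Nom; apply: hom => _; rewrite /h.
  by case: ifPn => // /set_mem.
rewrite !ge0_integralTE//; apply: le_ereal_sup => _ [s sf <-]; exists s => // om.
apply: le_trans (sf om) _; rewrite /h; case: ifPn => [_|/negP omN]; first exact: leey.
by apply: contrapT => fg; apply/omN/mem_set/fgN.
Qed.

Lemma ae_eq1 (f : Omega -> \bar R) : measurable_fun [set: Omega] f ->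
  (forall om, 0 <= f om)%E -> {ae mu, forall om, (f om <= 1)%E} ->
  (\int[mu]_om f om = 1)%E -> {ae mu, forall om, f om = 1%E}.
Proof.
move=> mf f0 f1 intf.
(* [f] may exceed 1 on a null set, hence the truncation. *)
pose g om := maxe (1 - f om)%E 0%E.
have g0 om : (0 <= g om)%E by rewrite /g le_max lexx orbT.
have mg : measurable_fun [set: Omega] g.
  by apply: measurable_maxe => //; exact: emeasurable_funB.
have fg : (\int[mu]_om (f om + g om) = 1)%E.
  transitivity (\int[mu]_om (cst 1 om))%E; last first.
    by rewrite integral_cst// mul1e; exact: probability_setT.
  apply: ge0_ae_eq_integral => //.
  - exact: emeasurable_funD.
  - by move=> om _; rewrite adde_ge0.
  - apply: filterS f1 => om f1 _ /=.
    have ffin : f om \is a fin_num by rewrite ge0_fin_numE// (le_lt_trans f1)// ltry.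
    by rewrite /g max_l ?sube_ge0 ?ffin ?orbT// addeC subeK.
have : (\int[mu]_om `|g om| = 0)%E.
  under eq_integral do rewrite gee0_abs//.
  move: fg; rewrite ge0_integralD// intf => fg.
  have := congr1 (fun x => x - 1)%E fg.
  by rewrite addeAC subee// add0e.
move=> /(ae_eq_integral_abs _ measurableT mg); apply: filterS2 f1 => om f1 /(_ I).
rewrite /g /= => /eqP gE; apply/eqP; rewrite eq_le f1 /=.
move: gE; rewrite eq_le => /andP[+ _]; rewrite ge_max => /andP[+ _].
by rewrite lee_subel_addr // ?add0e.
Qed.

End AlmostEverywhere.

Section MeasurePreserving.
Context {R : realType} {disp : measure_display} {Omega : measurableType disp}.
Variables (mu : probability Omega R) (phi : Omega -> Omega).
Hypothesis mphi : measurable_fun [set: Omega] phi.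
Hypothesis phi_mu : forall A, measurable A -> mu (phi @^-1` A) = mu A.

Lemma integral_measure_preserving (f : Omega -> \bar R) :
  measurable_fun [set: Omega] f -> (forall om, 0 <= f om)%E ->
  (\int[mu]_om f (phi om) = \int[mu]_om f om)%E.
Proof.
move=> mf f0; have := ge0_integral_pushforward mphi mu measurableT mf (fun om _ => f0 om).
rewrite preimage_setT => <-; apply: eq_measure_integral => A mA _.
exact: phi_mu.
Qed.

Lemma ae_measure_preserving (P : Omega -> Prop) :
  {ae mu, forall om, P om} -> {ae mu, forall om, P (phi om)}.
Proof.
move=> [N [mN N0 PN]]; exists (phi @^-1` N); split.
- by rewrite -[X in measurable X]setTI; exact: mphi.
- by rewrite phi_mu.
- by move=> om /= nP; exact: PN.
Qed.

End MeasurePreserving.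

Lemma ae_forall_count (R : realType) (disp : measure_display)
    (Omega : measurableType disp) (mu : {measure set Omega -> \bar R})
    (I : countType) (P : I -> Omega -> Prop) :
  (forall i, {ae mu, forall om, P i om}) -> {ae mu, forall om, forall i, P i om}.
Proof.
move=> aeP; have : {ae mu, forall om, forall n, oapp (P^~ om) True (@pickle_inv I n)}.
  apply: ae_foralln => n; case: pickle_inv => [i|] //=.
  exact: nearW.
by apply: filterS => om h i; have := h (choice.pickle i); rewrite pickleK_inv.
Qed.

(** * The orbit of eigenvectors of a covariant family *)

Section Covariant.
Context {R : realType} {d : nat} {disp : measure_display}.
Context {Omega : measurableType disp} (mu : probability Omega R).
Implicit Types (k l m : lattice d).

(** Evaluation at [k] is the continuous functional [inner (delta k)]. *)
Lemma open_normc_gt (k : lattice d) (r : R) :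
  open [set v : ell2 R d | r < normc (v k)].
Proof.
rewrite (_ : [set _ | _] = (fun v : ell2 R d => normc (v k)) @^-1` [set x | r < x])//.
apply: open_comp; last exact: open_gt.
move=> v _.
have ev : (fun w : ell2 R d => normc (w k)) =
    fun w => normc (inner (delta k) w).
  by apply/funext => w; rewrite inner_deltal.
rewrite /continuous_at ev -(inner_deltal k v).
have cont := @cvg_inner R d _ _ _ id (delta k) v (@cvg_id _ (nbhs v)).
exact: cvg_normc (cont _).
Qed.

Lemma measurable_normc_coord (u : Omega -> ell2 R d) k : borel_measurable u ->
  measurable_fun [set: Omega] (fun om => normc (u om k)).
Proof.
move=> mborel; apply: (measurability _ (RGenOInfty.measurableE R)) => _ [_ [x ->] <-].
have := mborel measurableT [set v : ell2 R d | x < normc (v k)].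
rewrite (_ : (fun om => normc (u om k)) @^-1` `]x, +oo[%classic =
   u @^-1` [set v : ell2 R d | x < normc (v k)]).
  by apply; apply: sub_sigma_algebra; exact: open_normc_gt.
by apply/seteqP; split=> om /=; rewrite in_itv/= andbT.
Qed.


Variables (S : lattice d -> Omega -> Omega).
Variables (H : Omega -> {linear ell2 R d -> ell2 R d}).
Variables (E : Omega -> R) (u : Omega -> ell2 R d).
Hypothesis covu : ergodic_covariant_family mu S H E u.
Hypothesis mborel : borel_measurable u.

Let e om m := translate (- m) (u (S m om)).

Let eE om m k : e om m k = u (S m om) (k + m).
Proof. by rewrite /e /= opprK. Qed.

Lemma ergodic_action_covariant : ergodic_action mu S.
Proof. by case: covu => -[]. Qed.

(** Integrating term by term, each [S m] can be removed because it preserves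
    the measure. Sums over the eigenvectors [e om m] thereby become sums over
    the sites of the single vector [u om]. *)
Lemma integral_esum_orbit (f : lattice d -> Omega -> \bar R) :
  (forall m om, 0 <= f m om)%E ->
  (forall m, measurable_fun [set: Omega] (f m)) ->
  (\int[mu]_om (\esum_(m in [set: lattice d]) f m (S m om)) =
   \int[mu]_om (\esum_(m in [set: lattice d]) f m om))%E.
Proof.
move=> f0 mf; have [_ mS Smu _ _] := ergodic_action_covariant.
rewrite !integral_esum// => [|m]; last exact: measurableT_comp.
apply: eq_esum => m _; apply: integral_measure_preserving => //.
exact: Smu.
Qed.

Lemma ae_orthonormal_orbit :
  {ae mu, forall om, Defs.orthonormal (e om)}.
Proof. by case: covu => _ _ _; apply: filterS => om []. Qed.

(** Covariance transports the eigenvalue equation at [S m om] to one at [om]. *)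
Lemma ae_eigen_orbit : {ae mu, forall om, forall m,
  H om (e om m) = (E (S m om))%:C%C *: e om m}.
Proof.
have [[[_ mS Smu _ _] _ _ covH] _ _ aeu] := covu.
have : {ae mu, forall om, forall m,
    H (S m om) (u (S m om)) = (E (S m om))%:C%C *: u (S m om)}.
  apply: ae_forall_count => m; apply: (ae_measure_preserving (mS m) (Smu m)
    (P := fun om => H om (u om) = (E om)%:C%C *: u om)).
  by apply: filterS aeu => om [].
apply: filterS => om h m; apply/val_inj/funext => k.
have := congr1 (fun v : ell2 R d => v (k + m)) (h m).
by rewrite covH /= addrK opprK.
Qed.

(** Completeness by counting: by Bessel the sum is at most 1, and by
    [integral_esum_orbit] its mean equals the mean of the squared norm of [u],
    which is 1. Hence it equals 1 almost everywhere. *)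
Lemma ae_complete_orbit : {ae mu, forall om, forall k,
  \esum_(m in [set: lattice d]) (normc (e om m k) ^+ 2)%:E = 1%E}.
Proof.
apply: ae_forall_count => k.
have m2 m : measurable_fun [set: Omega] (fun om => (normc (u om (k + m)) ^+ 2)%:E).
  by apply/measurable_EFinP; apply: measurable_funX; exact: measurable_normc_coord.
have [_ mS _ _ _] := ergodic_action_covariant.
apply: ae_eq1.
- apply: measurable_esum => m.
    by move=> om; rewrite lee_fin sqr_ge0.
  under eq_fun do rewrite eE.
  exact: measurableT_comp (m2 m) (mS m).
- by move=> om; apply: esum_ge0 => m _; rewrite lee_fin sqr_ge0.
- apply: filterS ae_orthonormal_orbit => om /esum_bessel /(_ (delta k)).
  rewrite ell2_norm_delta expr1n; apply: le_trans; apply: le_esum => m _.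
  by rewrite innerC inner_deltal normc_conj.
under eq_integral do under eq_esum do rewrite eE.
rewrite (integral_esum_orbit (f := fun m om => (normc (u om (k + m)) ^+ 2)%:E))//; last first.
  by move=> m om; rewrite lee_fin sqr_ge0.
transitivity (\int[mu]_om (cst 1 om))%E.
  apply: eq_integral => om _; have [_ _ nu _] := covu.
  rewrite /= -(nu om) /sqsum.
  by rewrite [RHS](reindex_esum [set: lattice d] [set: lattice d] (fun m => k + m)).
by rewrite integral_cst// mul1e; exact: probability_setT.
Qed.

(** Combines the time-independent bound [sup_evolution_le] for the eigenvectors
    [e om m] with [integral_esum_orbit]. *)
Lemma expected_evolution_le k l :
  (expected_evolution mu H k l <=
   \int[mu]_om (\esum_(m in [set: lattice d])
      (normc (u om (k + m)) * normc (u om (l + m)))%:E))%E.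
Proof.
have mm m : measurable_fun [set: Omega]
    (fun om => (normc (u om (k + m)) * normc (u om (l + m)))%:E).
  by apply/measurable_EFinP; apply: measurable_funM; exact: measurable_normc_coord.
have pos m om : (0 <= (normc (u om (k + m)) * normc (u om (l + m)))%:E)%E.
  by rewrite lee_fin mulr_ge0 ?normc_ge0.
have [[[_ mS _ _ _] _ saH _] _ _ _] := covu.
rewrite -(integral_esum_orbit (f := fun m om =>
  (normc (u om (k + m)) * normc (u om (l + m)))%:E))//.
apply: ge0_le_integral_ae.
- by move=> om; exact: sup_evolution_ge0.
- by move=> om; exact: esum_ge0.
- by apply: measurable_esum => // m; exact: measurableT_comp (mm m) (mS m).
near=> om.
have Ho : Defs.orthonormal (e om) by near: om; exact: ae_orthonormal_orbit.
have He : forall m, H om (e om m) = (E (S m om))%:C%C *: e om m.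
  by near: om; exact: ae_eigen_orbit.
have Hc : forall k, \esum_(m in [set: lattice d]) (normc (e om m k) ^+ 2)%:E = 1%E.
  by near: om; exact: ae_complete_orbit.
apply: le_trans (sup_evolution_le l (proj2 (saH om)) Ho He (Hc k)) _.
by apply: le_esum => m _; rewrite !eE.
Unshelve. all: by end_near. Qed.

End Covariant.

(** * From a layered bound to a decay rate *)

(** Each point lies in a layer [A i] on which [f] is at most [D i], so [f] is
    dominated by the series of the [D i] times the indicators of the [A i]. *)
Lemma integral_le_layers (R : realType) (disp : measure_display)
    (Omega : measurableType disp) (mu : probability Omega R)
    (f : Omega -> \bar R) (A : nat -> set Omega) (D : nat -> R) :
  (forall om, 0 <= f om)%E -> (forall i, measurable (A i)) -> (forall i, 0 <= D i) ->
  {ae mu, forall om, exists2 i, A i om & (f om <= (D i)%:E)%E} ->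
  (\int[mu]_om f om <= \sum_(i <oo) (D i)%:E * mu (A i))%E.
Proof.
move=> f0 mA D0 fD.
have term0 i om : (0 <= (D i)%:E * (\1_(A i) om)%:E)%E.
  by rewrite -EFinM lee_fin mulr_ge0// indicE.
have mterm i : measurable_fun [set: Omega] (fun om => (D i)%:E * (\1_(A i) om)%:E)%E.
  by apply: measurable_funeM; apply/measurable_EFinP; exact: measurable_indic.
have -> : (\sum_(i <oo) (D i)%:E * mu (A i) =
    \int[mu]_om (\sum_(i <oo) (D i)%:E * (\1_(A i) om)%:E))%E.
  rewrite integral_nneseries//; apply: eq_eseriesr => i _.
  rewrite ge0_integralZl// ?integral_indic ?setIT// ?lee_fin//.
  by apply/measurable_EFinP; exact: measurable_indic.
apply: ge0_le_integral_ae => //.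
- by move=> om; apply: nneseries_ge0 => i _ _; exact: term0.
- exact: (ge0_emeasurable_sum (P := xpredT) (fun n om _ _ => term0 n om) (fun n _ => mterm n)).
apply: filterS fD => om [i Ai fi]; apply: le_trans fi _.
apply: le_trans (nneseries_lim_ge i.+1 _); last by move=> n _ _; exact: term0.
rewrite big_nat_recr//= indicE mem_set// mule1 leeDr//.
by apply: sume_ge0 => n _; exact: term0.
Qed.

Section DecayRate.
Context {R : realType} {d : nat} {disp : measure_display}.
Context {Omega : measurableType disp} (mu : probability Omega R).
Variable H : Omega -> {linear ell2 R d -> ell2 R d}.

Lemma expected_evolution_ge0 k l : (0 <= expected_evolution mu H k l)%E.
Proof. by apply: integral_ge0 => om _; exact: sup_evolution_ge0. Qed.

(** Beyond a radius [N] with [ln B <= e N], the constant [B] costs at most [e]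
    in the rate. *)
Lemma decay_rate_ge (B s e : R) : 1 <= B -> 0 < e ->
  (forall n : lattice d, (expected_evolution mu H n 0%R <=
    (B * expR (- s * (norm1 n)%:R))%:E)%E) ->
  ((s - e)%:E <= decay_rate mu H)%E.
Proof.
move=> B1 e0 decB; have B0 : 0 < B by exact: lt_le_trans ltr01 B1.
have lnB0 : 0 <= ln B by rewrite ln_ge0.
pose N := (Num.truncn (ln B / e)).+1.
have NB : ln B <= e * N%:R by rewrite mulrC -ler_pdivrMr// ltW// truncnS_gt.
apply: le_trans (ereal_sup_ubound _); last by exists N.
apply: le_ereal_inf_tmp => _ [n /= Nn <-].
have n0 : 0 < (norm1 n)%:R :> R by rewrite ltr0n (leq_trans _ Nn).
have lnE : (lne (expected_evolution mu H n 0) <= (ln B - s * (norm1 n)%:R)%:E)%E.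
  apply: (@le_trans _ _ (lne (B * expR (- s * (norm1 n)%:R))%:E)).
    rewrite lee_lne ?decB// in_itv/= leey andbT.
      exact: expected_evolution_ge0.
    by rewrite lee_fin mulr_ge0 ?expR_ge0 ?(ltW B0).
  rewrite lne_EFin ?mulr_gt0 ?expR_gt0// lnM ?posrE ?expR_gt0// expRK.
  by rewrite mulNr.
have := lee_wpmul2l (_ : 0 <= ((norm1 n)%:R^-1)%:E)%E lnE.
rewrite lee_fin invr_ge0 ler0n => /(_ isT) lnE'.
rewrite leeNr; apply: le_trans lnE' _; rewrite -EFinM -EFinN lee_fin.
rewrite mulrC ler_pdivrMr//.
have : e * N%:R <= e * (norm1 n)%:R by rewrite ler_wpM2l ?ler_nat// ltW.
set M := (norm1 n)%:R in n0 *; move=> NM; have := le_trans NB NM; nra.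
Qed.

End DecayRate.

(** * Good eigenfunctions *)

Section GoodEigenfunctions.
Context {R : realType} {d : nat} {disp : measure_display}.
Context {Omega : measurableType disp} (mu : probability Omega R).
Variables (S : lattice d -> Omega -> Omega).
Variables (H : Omega -> {linear ell2 R d -> ell2 R d}).
Variables (E : Omega -> R) (u : Omega -> ell2 R d) (gamma : R).
Variables (Om : nat -> set Omega) (n : nat -> nat).
Variables (C : nat -> R) (Cm : nat -> nat -> R).

Let weight i := C i ^+ 2 *
  (1 + sup [set Cm i m * expR (gamma * m%:R) | m in [set m | (m < n i)%N]]).

Hypothesis covu : ergodic_covariant_family mu S H E u.
Hypothesis gamma0 : 0 < gamma.
Hypothesis Om0 : Om 0%N = set0.
Hypothesis mOm : forall i, (1 <= i)%N -> measurable (Om i).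
Hypothesis Om1 : mu (\bigcup_(i in [set i | (1 <= i)%N]) Om i) = 1%E.
Hypothesis n1 : forall i, (1 <= i)%N -> (1 <= n i)%N.
Hypothesis Cm01 : forall i m, (1 <= i)%N -> (m < n i)%N -> 0 < Cm i m < 1.
Hypothesis good : forall i om, (1 <= i)%N -> Om i om ->
  exists l : lattice d, (norm1 l < n i)%N /\
    good_eigenfunction (H om) gamma l (C i) (Cm i (norm1 l)) (u om).
Hypothesis mborel : borel_measurable u.
Hypothesis weight_fin :
  (\sum_(1 <= i <oo) (weight i)%:E * mu (~` Om i.-1) < +oo)%E.

Lemma amplitude_le_sup i m : (1 <= i)%N -> (m < n i)%N ->
  Cm i m * expR (gamma * m%:R) <=
  sup [set Cm i m * expR (gamma * m%:R) | m in [set m | (m < n i)%N]].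
Proof.
move=> i1 mn; apply: ub_le_sup; last by exists m.
exists (expR (gamma * (n i)%:R)) => _ [p /= pn <-].
have /andP[c0 c1] := Cm01 i1 pn.
apply: (@le_trans _ _ (1 * expR (gamma * p%:R))).
  by rewrite ler_wpM2r ?expR_ge0// ltW.
by rewrite mul1r ler_expR ler_wpM2l ?(ltW gamma0)// ler_nat ltnW.
Qed.

Lemma weight_ge0 i : (1 <= i)%N -> 0 <= weight i.
Proof.
move=> i1; rewrite mulr_ge0 ?sqr_ge0// addr_ge0//.
apply: le_trans (amplitude_le_sup i1 (n1 i1)).
by have /andP[c0 _] := Cm01 i1 (n1 i1); rewrite mulr_ge0 ?expR_ge0// ltW.
Qed.

Lemma esum_good_le (e : R) k l i om : 0 < e -> e <= gamma -> (1 <= i)%N -> Om i om ->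
  (\esum_(m in [set: lattice d]) (normc (u om (k + m)) * normc (u om (l + m)))%:E <=
   (weight i * expR (- (gamma - e) * (norm1 (k - l))%:R))%:E *
   (2%:E * \esum_(m in [set: lattice d]) (expR (- e * (norm1 m)%:R))%:E))%E.
Proof.
move=> e0 eg i1 /(good i1)[p [pn [_ _ le_u]]].
have /andP[c0 c1] := Cm01 i1 pn.
apply: le_trans (esum_pair_le (w := fun n => normc (u om n)) k l e0 eg _ _ le_u) _.
- by rewrite !ltW.
- by move=> m; exact: normc_ge0.
apply: lee_wpmul2r.
  by rewrite mule_ge0//; apply: esum_ge0 => m _; rewrite lee_fin expR_ge0.
rewrite lee_fin ler_wpM2r ?expR_ge0// ler_wpM2l ?sqr_ge0// lerD2l.
exact: amplitude_le_sup.
Qed.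

(** Almost every point has a first index [i >= 1] at which it enters [Om i];
    at that index it lies outside [Om i.-1], also when [i = 1] as [Om 0] is
    empty. Hence the integral over the points entering at stage [i] is
    controlled by the measure of the complement of [Om i.-1]. *)
Lemma ae_first_layer : {ae mu, forall om, exists i,
  [/\ (1 <= i)%N, Om i om & ~ Om i.-1 om]}.
Proof.
have mU : measurable (\bigcup_(i in [set i | (1 <= i)%N]) Om i).
  by apply: bigcup_measurable => i; exact: mOm.
exists (~` \bigcup_(i in [set i | (1 <= i)%N]) Om i); split.
- exact: measurableC.
- rewrite probability_setC//; move: Om1 => /= ->; exact: subee.
- move=> om /= nex [i i1 Omi]; apply: nex.
  have ex : exists j, `[< (1 <= j)%N /\ Om j om >] by exists i; apply/asboolP.
  case: (ex_minnP ex) => j /asboolP[j1 Omj] jmin; exists j; split=> // Omj'.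
  case: j j1 Omj jmin Omj' => // -[|j] _ _ jmin /=; first by rewrite Om0.
  move=> Omj; have := jmin j.+1; rewrite ltnn => h; suff : false by [].
  by apply: h; apply/asboolP.
Qed.

(** All exponents [gamma - e] below [gamma] are reached; the loss [e] makes the
    lattice sum of [esum_pair_le] finite, and the summability hypothesis makes
    the resulting constant uniform over the layers. *)
Lemma expected_evolution_decay (e : R) : 0 < e -> e <= gamma ->
  exists2 B : R, 1 <= B & forall k l,
    (expected_evolution mu H k l <=
     (B * expR (- (gamma - e) * (norm1 (k - l))%:R))%:E)%E.
Proof.
move=> e0 eg; set L := (2%:E * \esum_(m in [set: lattice d])
  (expR (- e * (norm1 m)%:R))%:E)%E.
have L0 : (0 <= L)%E.
  by rewrite mule_ge0//; apply: esum_ge0 => m _; rewrite lee_fin expR_ge0.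
have Lfin : L \is a fin_num.
  by rewrite ge0_fin_numE// lte_mul_pinfty ?lee_fin//; exact: esum_exp_norm1.
(* The layers start at 1; at index 0 the weight may be negative. *)
pose D i := if (1 <= i)%N then weight i else 0.
have D0 i : 0 <= D i by rewrite /D; case: ifPn => // i1; exact: weight_ge0.
have mA i : measurable (~` Om i.-1).
  by apply: measurableC; case: i => [|[|i]] /=; rewrite ?Om0//; exact: mOm.
pose W := (\sum_(i <oo) (D i)%:E * mu (~` Om i.-1))%E.
have W0 : (0 <= W)%E by apply: nneseries_ge0 => i _ _; rewrite mule_ge0// lee_fin.
have Wfin : W \is a fin_num.
  rewrite ge0_fin_numE// (_ : W = \sum_(1 <= i <oo) (weight i)%:E * mu (~` Om i.-1))%E//.
  rewrite ereal_series eseries_mkcond; apply: eq_eseriesr => i _.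
  by rewrite /D; case: ifP => //; rewrite mul0e.
exists (1 + fine L * fine W); first by rewrite lerDl mulr_ge0// fine_ge0.
move=> k l; set dec := expR _; have dec0 : 0 <= dec by exact: expR_ge0.
apply: (@le_trans _ _ (\sum_(i <oo) (fine L * dec * D i)%:E * mu (~` Om i.-1))%E).
  apply: le_trans (expected_evolution_le covu mborel k l) _.
  apply: integral_le_layers => //.
  - by move=> om; apply: esum_ge0 => m _; rewrite lee_fin mulr_ge0 ?normc_ge0.
  - by move=> i; rewrite !mulr_ge0// fine_ge0.
  apply: filterS ae_first_layer => om [i [i1 Omi Omi']]; exists i => //.
  apply: le_trans (esum_good_le k l e0 eg i1 Omi) _.
  rewrite -/L -[in leLHS](fineK Lfin) -EFinM lee_fin /D i1 -/dec.
  by rewrite [leLHS]mulrC [weight i * _]mulrC mulrA.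
under eq_eseriesr do rewrite EFinM -muleA.
rewrite nneseriesZl; last by move=> i _; rewrite mule_ge0// lee_fin.
rewrite -/W -(fineK Wfin) -EFinM lee_fin mulrAC ler_wpM2r//.
by rewrite lerDr.
Qed.

End GoodEigenfunctions.

(** * Localization *)

Theorem theorem1p4 (R : realType) (d : nat) (disp : measure_display)
    (Omega : measurableType disp) (mu : probability Omega R)
    (S : lattice d -> Omega -> Omega)
    (H : Omega -> {linear ell2 R d -> ell2 R d})
    (E : Omega -> R) (u : Omega -> ell2 R d) (gamma : R)
    (Om : nat -> set Omega) (n : nat -> nat)
    (C : nat -> R) (Cm : nat -> nat -> R) :
  ergodic_covariant_family mu S H E u ->
  0 < gamma ->
  Om 0%N = set0 ->
  (forall i, (1 <= i)%N -> measurable (Om i)) ->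
  (forall i, (1 <= i)%N -> Om i `<=` Om i.+1) ->
  mu (\bigcup_(i in [set i | (1 <= i)%N]) Om i) = 1%E ->
  (forall i, (1 <= i)%N -> (1 <= n i)%N) ->
  (forall i, (1 <= i)%N -> 0 < C i) ->
  (forall i m, (1 <= i)%N -> (m < n i)%N -> 0 < Cm i m < 1) ->
  (forall i om, (1 <= i)%N -> Om i om ->
    exists l : lattice d, (norm1 l < n i)%N /\
      good_eigenfunction (H om) gamma l (C i) (Cm i (norm1 l)) (u om)) ->
  borel_measurable u ->
  (\sum_(1 <= i <oo)
     (C i ^+ 2 *
        (1 + sup [set Cm i m * expR (gamma * m%:R)
                 | m in [set m | (m < n i)%N]]))%:E *
     mu (~` Om i.-1) < +oo)%E ->
  EDL mu H /\ (gamma%:E <= decay_rate mu H)%E.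
Proof.
move=> covu g0 Om0 mOm _ Om1 n1 _ Cm01 good mborel Wfin.
have decay e (e0 : 0 < e) (eg : e <= gamma) := expected_evolution_decay
  covu g0 Om0 mOm Om1 n1 Cm01 good mborel Wfin e0 eg.
split.
  have g2 : 0 < gamma / 2 by rewrite divr_gt0.
  have [|B B1 decB] := decay _ g2; first by rewrite ler_pdivrMr// ler_peMr ?ler1n// ltW.
  exists B, (gamma / 2); split=> // [|k l]; first exact: lt_le_trans ltr01 B1.
  by rewrite {1}(_ : gamma / 2 = gamma - gamma / 2)//; field.
apply/lee_addgt0Pr => e e0.
(* Half of [e] is the loss in the exponent, the other half absorbs the constant
   [B]. *)
pose a := Num.min (e / 2) gamma.
have a0 : 0 < a by rewrite lt_min divr_gt0.
have [|B B1 decB] := decay _ a0; first by rewrite ge_min lexx orbT.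
have decB0 (m : lattice d) : (expected_evolution mu H m 0%R <=
    (B * expR (- (gamma - a) * (norm1 m)%:R))%:E)%E.
  by have := decB m 0; rewrite subr0.
have e2 : 0 < e / 2 by rewrite divr_gt0.
rewrite -leeBlDr//; apply: le_trans (decay_rate_ge B1 e2 decB0).
rewrite lee_fin -subr_ge0; have : a <= e / 2 by rewrite ge_min lexx.
by move=> ae; rewrite (_ : _ - _ = e / 2 - a) ?subr_ge0//; field.
Qed.
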